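(* Fix an integer $n\ge 3$. There exist constants $C=C(n)<\infty$ and $\theta=\theta(n)\in(0,1)$, independent of $m$, such that for every integer $m\ge 2$ and every integer $\ell\ge 1$, the uniform spanning tree $T$ of the wired cylindrical graph $G_{n,m}^{\mathrm s}$ satisfies $$\mathbb P\bigl(\exists\text{ a sink-trunk }L\subset T\text{ such that every branch off }L\text{ has length}<\ell\bigr)\;\ge\;1-C\,m^3\,\theta^{\ell}.$$
   Context: For $n\ge 3$, $m\ge 2$, the cylindrical graph $G_{n,m}=C_n\times P_m$ has vertex set $\{(i,j): i\in\mathbb{Z}_n,\ j\in\{0,\dots,m-1\}\}$ and edges $\{(i,j),(i+1,j)\}$ ($i\in\mathbb{Z}_n$, $0\le j\le m-1$) and $\{(i,j),(i,j+1)\}$ ($i\in\mathbb{Z}_n$, $0\le j\le m-2$). Its rings are $R_k=\{(i,k): i\in\mathbb{Z}_n\}$, $k=0,\dots,m-1$. The wired cylindrical graph $G_{n,m}^{\mathrm s}$ is obtained from $G_{n,m}$ by adding one new vertex $s$ (the sink) and the edges $\{s,v\}$ for all $v\in R_0\cup R_{m-1}$. A uniform spanning tree of a finite connected graph is a spanning tree chosen uniformly among all its spanning trees. A trunk of a spanning tree $T$ of $G_{n,m}^{\mathrm s}$ is a simple path $L\subset T$ with $L\cap R_k\neq\varnothing$ for every $k=0,\dots,m-1$; a sink-trunk is a trunk $L\subset T$ with $s\in L$. Given a trunk $L\subset T$, every connected component $B$ of $T\setminus V(L)$ is adjacent in $T$ to a unique vertex $a(B)\in V(L)$; the corresponding branch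 off $L$ is the subtree induced by $V(B)\cup\{a(B)\}$, and its length is $\max_{v\in V(B)} d_T(v,a(B))$, where $d_T$ is the graph distance in $T$. *)

(* Defs.v *)
From mathcomp Require Import all_boot all_order all_algebra.
From mathcomp Require Import boolp reals.

Set Implicit Arguments.
Unset Strict Implicit.
Unset Printing Implicit Defensive.

Import Order.TTheory GRing.Theory Num.Theory.

(* A finite simple graph on V is a symmetric irreflexive relation.  A spanning
   subgraph is identified with its set of edges, an edge being the unordered
   pair [set x; y] with x != y. *)

Definition edges (V : finType) (e : rel V) : {set {set V}} :=
  [set E : {set V} | [exists x, [exists y, e x y && (E == [set x; y])]]].

Definition edge_rel (V : finType) (T : {set {set V}}) : rel V :=
  fun x y => (x != y) && ([set x; y] \in T).

Definition connected_graph (V : finType) (e : rel V) : Prop :=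
  forall x y, connect e x y.

(* For a symmetric irreflexive e, a duplicate-free closed e-path with at most
   two vertices is empty or runs back and forth along an edge, hence is not a
   cycle of the graph. *)
Definition acyclic_graph (V : finType) (e : rel V) : Prop :=
  forall c : seq V, ucycle e c -> size c <= 2.

Definition is_spanning_tree (V : finType) (e : rel V) (T : {set {set V}}) :
    Prop :=
  [/\ T \subset edges e, connected_graph (edge_rel T)
    & acyclic_graph (edge_rel T)].

Definition spanning_trees (V : finType) (e : rel V) : {set {set {set V}}} :=
  [set T : {set {set V}} | `[< is_spanning_tree e T >]].

Definition ust_prob (R : realType) (V : finType) (e : rel V)
    (A : {set {set V}} -> Prop) : R :=
  (#|[set T in spanning_trees e | `[< A T >]]|%:R / #|spanning_trees e|%:R)%R.

(* The minimum of the lengths k of the walks from x to y.  A shortest walk has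
   length less than #|V|; the value is #|V| when there is no walk. *)
Definition graph_dist (V : finType) (e : rel V) (x y : V) : nat :=
  \big[minn/#|V|]_(k < #|V| |
    [exists p : k.-tuple V, path e x p && (last x p == y)]) k.

Definition simple_path (V : finType) (e : rel V) (L : seq V) : bool :=
  [&& L != [::], sorted e L & uniq L].

Definition is_component_off (V : finType) (e : rel V) (L : seq V)
    (B : {set V}) : Prop :=
  exists2 x : V, x \notin L &
    B = [set y | connect [rel u v | [&& u \notin L, v \notin L & e u v]] x y].

(* The branch is the subtree induced by a |: B.  When e is a tree and L a path
   in it, a is determined by B. *)
Definition is_branch_off (V : finType) (e : rel V) (L : seq V)
    (B : {set V}) (a : V) : Prop :=
  [/\ is_component_off e L B, a \in L & exists2 v : V, v \in B & e v a].

Definition branch_length (V : finType) (e : rel V) (B : {set V}) (a : V) : nat :=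
  \max_(v in B) graph_dist e v a.

(* The cyclic group Z_n is 'I_n with its cyclic successor ordS; the sink is
   None. *)

Definition cyl_vertex (n m : nat) : finType := ('I_n * 'I_m)%type.

Definition wired_vertex (n m : nat) : finType := option (cyl_vertex n m).

Definition cyl_adj (n m : nat) : rel (cyl_vertex n m) := fun u v =>
  (u.2 == v.2) && ((v.1 == ordS u.1) || (u.1 == ordS v.1))
  || (u.1 == v.1) && ((v.2 == u.2.+1 :> nat) || (u.2 == v.2.+1 :> nat)).

Definition cyl_boundary (n m : nat) (v : cyl_vertex n m) : bool :=
  (v.2 == 0 :> nat) || (v.2.+1 == m).

Definition wired_adj (n m : nat) : rel (wired_vertex n m) := fun u v =>
  match u, v with
  | Some x, Some y => cyl_adj x y
  | Some x, None => cyl_boundary x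
  | None, Some y => cyl_boundary y
  | None, None => false
  end.

Definition ring_set (n m : nat) (k : 'I_m) : {set wired_vertex n m} :=
  [set Some (i, k) | i : 'I_n].

Definition is_trunk (n m : nat) (T : {set {set wired_vertex n m}})
    (L : seq (wired_vertex n m)) : Prop :=
  simple_path (edge_rel T) L
  /\ forall k : 'I_m, exists2 v, v \in L & v \in ring_set n k.

Definition is_sink_trunk (n m : nat) (T : {set {set wired_vertex n m}})
    (L : seq (wired_vertex n m)) : Prop :=
  is_trunk T L /\ None \in L.

(* Main.v *)
Require Import Defs.
From mathcomp Require Import all_boot all_order all_algebra.
From mathcomp Require Import boolp reals.
From mathcomp Require Import zify lra.

Set Implicit Arguments.
Unset Strict Implicit.
Unset Printing Implicit Defensive.

Import Order.TTheory GRing.Theory Num.Theory.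

(** Call a ring good in T when T restricted to it is connected.  A trunk meets
    every ring, so a vertex on a good ring is at tree distance less than n from
    any trunk; hence a branch of length at least l off any sink-trunk runs
    through about l / n consecutive rings that are not good.  On the other
    hand, keeping the edges of T that do not touch a given ring, one can always
    complete them to a spanning tree in which this ring is good.  There are at
    most D = n (3 n + 1) edges touching the ring, so each ring is good with
    conditional probability at least 2^-D, and h given rings all fail to be
    good with probability at most (1 - 2^-D)^h.  A union bound over the position
    of the window of rings concludes. *)

(** * Resampling a spanning tree near a vertex set *)

Definition induced_rel (V : finType) (X : {set V}) (e : rel V) : rel V :=
  fun u v => [&& u \in X, v \in X & e u v].

Definition spans_connected (V : finType) (T : {set {set V}}) (X : {set V}) :
    bool :=
  [forall x in X, forall y in X, connect (induced_rel X (edge_rel T)) x y].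

Definition avoiding (V : finType) (T : {set {set V}}) (X : {set V}) :
    {set {set V}} :=
  [set E in T | [disjoint E & X]].

Lemma spans_connectedP (V : finType) (T : {set {set V}}) (X : {set V}) :
  reflect {in X &, forall x y, connect (induced_rel X (edge_rel T)) x y}
          (spans_connected T X).
Proof.
apply: (iffP forall_inP) => [h x y xX yX|h x xX].
  exact: (forall_inP (h x xX)).
by apply/forall_inP => y yX; apply: h.
Qed.

Section Graphs.
Variable V : finType.
Implicit Types (T F U : {set {set V}}) (X : {set V}) (e : rel V).

Lemma edge_rel_sym T : symmetric (edge_rel T).
Proof. by move=> x y; rewrite /edge_rel eq_sym setUC. Qed.

Lemma induced_rel_sym X e : symmetric e -> symmetric (induced_rel X e).
Proof. by move=> es x y; rewrite /induced_rel es andbCA. Qed.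

Lemma edge_relS T F : T \subset F -> subrel (edge_rel T) (edge_rel F).
Proof.
by move=> /subsetP TF x y /andP[xy xyT]; rewrite /edge_rel xy TF.
Qed.

Lemma edge_relD1 T E u v :
  edge_rel (T :\ E) u v = ([set u; v] != E) && edge_rel T u v.
Proof. by rewrite /edge_rel !inE andbCA. Qed.

(** A walk through the removed edge can be rerouted along the rest of the cycle. Keeping [e']
    abstract serves both a whole graph and the subgraph induced on a vertex set. *)
Lemma connect_remove_cycle_edge e e' (c : seq V) x :
    symmetric e' -> ucycle e c -> 2 < size c -> x \in c ->
    (forall u v, e u v -> [set u; v] != [set x; next c x] -> e' u v) ->
  subrel (connect e) (connect e').
Proof.
move=> e's /andP[ec uc] sc xc ee'.
have [i s cE] := rot_to xc.
have := uc; rewrite -(rot_uniq i) cE; move: ec; rewrite -(rot_cycle i) cE.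
have nE : next c x = next (x :: s) x by rewrite -cE next_rot.
have : 2 < size (x :: s) by rewrite -cE size_rot.
case: s {cE} nE => // y [//|z s] /=; rewrite eqxx => nE _.
rewrite nE in ee'; rewrite !rcons_path.
move=> /and4P[exy eyz pzs lx]; rewrite !inE !negb_or.
move=> /and4P[/and3P[xy xz xs] /andP[yz ys] zs us].
have NE (a b : V) : x != a -> x != b -> [set a; b] != [set x; y].
  move=> xa xb; apply: contraNneq xa => /setP/(_ x).
  by rewrite !inE eqxx (negPf xb) orbF => ->.
(* Go round the cycle from [y] to [x]: the earlier steps miss [x], and the last one starts from a
   vertex other than [y] because the cycle has a third vertex. *)
have cyx : connect e' y x.
  apply/connectP; exists (rcons (z :: s) x); last by rewrite last_rcons.
  rewrite rcons_path /= -andbA; apply/and3P; split.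
  - by apply: ee' => //; apply: NE.
  - apply: (@sub_in_path _ (predC1 x) e) => // [a b|]; last first.
      rewrite /= eq_sym xz /=; apply/allP => w ws /=.
      by apply: contraNneq xs => <-.
    by rewrite !inE !(eq_sym _ x) => xa xb eab; apply: ee' => //; apply: NE.
  - apply: ee' => //; apply/negP => /eqP/setP/(_ y).
    rewrite !inE eqxx (eq_sym y x) (negPf xy) orbF orbT => /eqP yE.
    have := mem_last z s; rewrite -yE inE (negPf yz) /=.
    by rewrite (negPf ys).
have cs := sym_connect_sym e's.
apply: connect_sub => u v euv.
have [uvE|uvN] := eqVneq [set u; v] [set x; y]; last exact/connect1/ee'.
have := set21 u v; have := set22 u v; rewrite uvE !inE.
by move=> /orP[]/eqP-> /orP[]/eqP->; rewrite ?connect0 // cs.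
Qed.

(* Minimality: an edge of a cycle of a minimal T could be removed, unless the
   cycle lies in the acyclic part avoiding X. *)
Lemma spanning_tree_between e U X :
    U \subset edges e -> connected_graph (edge_rel U) -> spans_connected U X ->
    acyclic_graph (edge_rel (avoiding U X)) ->
  exists T, [/\ is_spanning_tree e T, T \subset U, spans_connected T X
    & avoiding T X = avoiding U X].
Proof.
move=> Ue Uc UX Fa; set F := avoiding U X.
pose P T := [&& F \subset T, spans_connected T setT & spans_connected T X].
have cT T : spans_connected T setT <-> connected_graph (edge_rel T).
  have iT : induced_rel setT (edge_rel T) =2 edge_rel T.
    by move=> u v; rewrite /induced_rel !inE.
  split=> [/spans_connectedP h x y|h].
    by rewrite -(eq_connect iT); apply: h; rewrite inE.
  by apply/spans_connectedP => x y _ _; rewrite (eq_connect iT).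
have PU : P U.
  apply/and3P; split=> //; last exact/cT.
  by apply/subsetP => E; rewrite inE => /andP[].
have [T /minsetP[/and3P[FT /cT Tc TX] Tmin] TU] := minset_exists PU.
have avT : avoiding T X = F.
  apply/setP => E; rewrite !inE; apply/andP/andP => -[ET dE]; split=> //.
    exact: (subsetP TU).
  by apply: (subsetP FT); rewrite inE ET.
exists T; split=> //; split=> //; first exact: subset_trans TU Ue.
move=> c uc; rewrite leqNgt; apply/negP => sc.
have /andP[ec uqc] := uc.
(* By minimality of [T], deleting an edge of a cycle must disconnect [X] or remove an edge of [F],
   since global connectivity survives. *)
have keep x : x \in c ->
    ~~ (spans_connected (T :\ [set x; next c x]) X
      && ([set x; next c x] \notin F)).
  move=> xc; set E := [set _; _]; apply/negP => /andP[TEX EF].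
  have /setP/(_ E) : T :\ E = T.
    apply: Tmin; last exact: subD1set.
    apply/and3P; split=> //; first by rewrite subsetD1 FT.
    apply/cT => a b; have := Tc a b.
    apply: (connect_remove_cycle_edge _ uc sc xc); first exact: edge_rel_sym.
    by move=> u v euv uvE; rewrite edge_relD1 uvE.
  have /andP[_] := next_cycle ec xc.
  by rewrite !inE eqxx => ->.
have notF x : (x \in X) || (next c x \in X) -> [set x; next c x] \notin F.
  move=> xX; rewrite inE negb_and; apply/orP; right; apply/negP => /pred0P dE.
  case/orP: xX => h.
    by have := dE x; rewrite /= h !inE eqxx.
  by have := dE (next c x); rewrite /= h !inE eqxx orbT.
(* An edge with exactly one end in [X] is neither in [F] nor used inside [X], so it could be
   deleted. Hence the cycle lies inside [X] or misses it. *)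
have same x : x \in c -> (x \in X) = (next c x \in X).
  move=> xc; apply/eqP/negPn/negP => xN.
  have := keep x xc; rewrite notF ?andbT; last first.
    by move: xN; case: (x \in X); case: (_ \in X).
  case/negP; apply/spans_connectedP => a b aX bX.
  have := spans_connectedP _ _ TX a b aX bX.
  apply: connect_sub => u v /and3P[uX vX euv]; apply: connect1.
  rewrite /induced_rel uX vX edge_relD1 euv andbT.
  apply: contraNneq xN => /setP uvE.
  have xuv : x \in [set u; v] by rewrite uvE set21.
  have yuv : next c x \in [set u; v] by rewrite uvE set22.
  by move: xuv yuv; rewrite !inE => /orP[]/eqP-> /orP[]/eqP->; rewrite ?uX ?vX.
have {}same x y : x \in c -> y \in c -> (x \in X) = (y \in X).
  have tr : transitive (fun u v => (u \in X) == (v \in X)).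
    by move=> ? ? ? /eqP-> /eqP->.
  have cyc : cycle (fun u v => (u \in X) == (v \in X)) c.
    by apply: cycle_from_next => // u uc'; rewrite -same.
  move: cyc; rewrite (cycle_all2rel tr) => /allrelP al.
  by move=> xc yc; apply/eqP/al.
have [x xc] : exists x, x \in c.
  by case: (c) sc => // x s _; exists x; apply: mem_head.
(* Inside [X], the cycle reroutes walks within [X], so an edge could be deleted; outside [X], it
   would be a cycle of the acyclic [F]. *)
case: (boolP (x \in X)) => xX.
- have cX y : y \in c -> y \in X by move=> yc; rewrite -(same x).
  have := keep x xc; rewrite notF ?xX // andbT => /negP[].
  apply/spans_connectedP => a b aX bX.
  have := spans_connectedP _ _ TX a b aX bX.
  apply: (@connect_remove_cycle_edge _ _ c x) => //.
  + exact/induced_rel_sym/edge_rel_sym.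
  + apply/andP; split=> //; apply: cycle_from_next => // z zc.
    by rewrite /induced_rel !cX ?mem_next // next_cycle.
  + move=> u v /and3P[uX vX euv] uvE.
    by rewrite /induced_rel uX vX edge_relD1 uvE.
- have cX y : y \in c -> y \notin X by move=> yc; rewrite -(same x).
  have : ucycle (edge_rel F) c.
    apply/andP; split=> //; apply: cycle_from_next => // z zc.
    have /andP[nz zT] := next_cycle ec zc.
    rewrite /edge_rel nz inE (subsetP TU) //=.
    rewrite disjoint_subset; apply/subsetP => w; rewrite !inE.
    by case/orP=> /eqP->; apply: cX; rewrite ?mem_next.
  by move/Fa; rewrite leqNgt sc.
Qed.

(** Adding to [T] all edges inside [X] connects [X] and leaves the edges avoiding [X] unchanged,
    hence acyclic. The surplus is then pruned. *)
Lemma resample_connected e T X :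
    is_spanning_tree e T -> spans_connected (edges e) X ->
  exists T', [/\ is_spanning_tree e T', spans_connected T' X
    & avoiding T' X = avoiding T X].
Proof.
move=> [Te Tc Ta] eX.
pose U := T :|: [set E in edges e | E \subset X].
have TU : T \subset U by apply: subsetUl.
have Ue : U \subset edges e.
  by rewrite subUset Te; apply/subsetP => E; rewrite inE => /andP[].
have avU : avoiding U X = avoiding T X.
  apply/setP => E; rewrite !inE andb_orl -[RHS]orbF; congr orb.
  apply/negbTE/negP => /andP[/andP[+ EX] dEX].
  move=> /existsP[x /existsP[y /andP[_ /eqP Exy]]].
  move: dEX => /pred0P/(_ x) /=.
  by rewrite (subsetP EX) Exy set21.
have [||||T' [T'e _ T'X avT']] := @spanning_tree_between e U X.
- by [].
- by move=> x y; apply: (connect_sub _ (Tc x y)) => u v /(edge_relS TU)/connect1.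
- apply/spans_connectedP => a b aX bX.
  have := spans_connectedP _ _ eX a b aX bX.
  apply: connect_sub => u v /and3P[uX vX /andP[uv uve]]; apply: connect1.
  rewrite /induced_rel uX vX /edge_rel uv !inE; apply/orP; right.
  move: uve; rewrite inE => -> /=.
  by apply/subsetP => w; rewrite !inE => /orP[]/eqP->.
- rewrite avU => c /andP[cc uc]; apply: Ta; apply/andP; split=> //.
  apply: sub_cycle cc; apply: edge_relS.
  by apply/subsetP => E; rewrite inE => /andP[].
by exists T'; rewrite avT'.
Qed.

(** Take the whole vertex set as [X]: no edge avoids it, so the acyclicity condition is vacuous. *)
Lemma exists_spanning_tree e :
  connected_graph (edge_rel (edges e)) -> exists T, is_spanning_tree e T.
Proof.
move=> ec; have [||||T []] := @spanning_tree_between e (edges e) setT => //.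
- apply/spans_connectedP => x y _ _; apply: etrans (ec x y).
  by apply: eq_connect => u v; rewrite /induced_rel !inE.
- case=> [|x [|y c]] // /andP[] /=; rewrite {1}/edge_rel inE.
  move=> /andP[/and3P[_ _ /pred0P/(_ x)]].
  by rewrite /= !inE eqxx.
- by exists T.
Qed.

(** An edge with both ends in [Y] does not touch [X]. Thus resampling at one ring does not affect
    whether another ring is good. *)
Lemma spans_connected_avoiding T F X (Y : {set V}) :
    [disjoint X & Y] -> avoiding T X = avoiding F X ->
  spans_connected T Y = spans_connected F Y.
Proof.
move=> dXY TF.
suff iT U : induced_rel Y (edge_rel U) =2 induced_rel Y (edge_rel (avoiding U X)).
  have cE x y : connect (induced_rel Y (edge_rel T)) x y
      = connect (induced_rel Y (edge_rel F)) x y.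
    by rewrite (eq_connect (iT T)) (eq_connect (iT F)) TF.
  apply/spans_connectedP/spans_connectedP => h x y xY yY;
    by have := h x y xY yY; rewrite cE.
move=> u v; rewrite /induced_rel /edge_rel inE.
case uY: (u \in Y); case vY: (v \in Y) => //=; rewrite andbA.
suff -> : [disjoint [set u; v] & X] by rewrite andbT.
rewrite disjoint_sym disjoint_subset; apply/subsetP => w wX; rewrite !inE.
move: dXY => /pred0P/(_ w); rewrite /= wX /= => wY.
by rewrite negb_or; apply/andP; split; apply: contraFneq wY => ->.
Qed.

Definition disconnecting_trees (I : finType) e (X : I -> {set V}) (J : {set I})
    : {set {set {set V}}} :=
  [set T in spanning_trees e | [forall j in J, ~~ spans_connected T (X j)]].

(** This is the probability bound (1 - 2^-D)^h with h = [#|J|], cleared of denominators. By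
    induction, each index of [J] contributes one factor 1 - 2^-D. *)
Lemma card_disconnecting_trees (I : finType) e (X : I -> {set V}) D :
    (forall i j, i != j -> [disjoint X i & X j]) ->
    (forall i, spans_connected (edges e) (X i)) ->
    (forall i, #|edges e :\: avoiding (edges e) (X i)| <= D) ->
  forall J : {set I}, #|disconnecting_trees e X J| * (2 ^ D) ^ #|J|
    <= (2 ^ D).-1 ^ #|J| * #|spanning_trees e|.
Proof.
move=> dX cX De J; move: {2}#|J| (erefl #|J|) => k.
elim: k J => [|k IH] J Jk.
  rewrite Jk !expn0 muln1 mul1n; apply: subset_leq_card.
  by apply/subsetP => T; rewrite inE => /andP[].
have [i iJ] : exists i, i \in J by apply/card_gt0P; rewrite Jk.
pose K := J :\ i.
have Kk : #|K| = k by have := cardsD1 i J; rewrite iJ Jk => -[].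
have := IH K Kk; rewrite Jk Kk.
set B := disconnecting_trees e X K.
pose G := [set T in B | spans_connected T (X i)].
have BE : #|disconnecting_trees e X J| + #|G| = #|B|.
  rewrite addnC -(cardsID [set T | spans_connected T (X i)] B); congr (_ + _).
    by congr #|pred_of_set _|; apply/setP => T; rewrite !inE.
  congr #|pred_of_set _|; apply/setP => T; rewrite !inE [RHS]andbC -[RHS]andbA.
  congr (_ && _); apply/forall_inP/andP => [h|[/forall_inP h iT] j jJ].
    split; last exact: h.
    by apply/forall_inP => j; rewrite inE => /andP[_ jJ]; apply: h.
  have [->//|ji] := eqVneq j i.
  by apply: h; rewrite !inE ji.
(* It suffices that a share at least 2^-D of the trees in [B] connects [X i]. *)
suff GB : #|B| <= #|G| * 2 ^ D.
  have N0 : 0 < 2 ^ D by rewrite expn_gt0.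
  move: GB N0; rewrite !expnS; move: (2 ^ D) => N GB N0 IHB.
  have dN : #|disconnecting_trees e X J| * N <= N.-1 * #|B| by nia.
  rewrite mulnA -[leqRHS]mulnA; apply: leq_trans (leq_mul dN (leqnn _)) _.
  by rewrite -mulnA leq_mul2l IHB orbT.
(* The default [T] is never reached on [B], where [resample_connected] supplies a candidate. *)
pose f T := odflt T [pick T' in G | avoiding T' (X i) == avoiding T (X i)].
have fP T : T \in B -> f T \in G /\ avoiding (f T) (X i) = avoiding T (X i).
  move=> TB; rewrite /f; case: pickP => [T' /andP[? /eqP//]|/= noT'].
  move: (TB); rewrite !inE => /andP[/asboolP Tt /forall_inP TK].
  have [T' [T't T'X avT']] := resample_connected Tt (cX i).
  have := noT' T'; rewrite avT' eqxx andbT !inE T'X andbT asboolT //= => /negP[].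
  apply/forall_inP => j jK; rewrite (@spans_connected_avoiding _ T (X i)) ?TK //.
  by apply: dX; move: jK; rewrite !inE eq_sym => /andP[].
(* A tree is recovered from its edges avoiding [X i], which [f T] shares, and its edges touching
   [X i], a subset of at most [D] possible ones. *)
pose g T := (f T, T :\: avoiding T (X i)).
have ginj : {in B &, injective g}.
  move=> T F TB FB [fTF dTF].
  have avTF : avoiding T (X i) = avoiding F (X i).
    by rewrite -(fP T TB).2 -(fP F FB).2 fTF.
  have avS U : avoiding U (X i) \subset U.
    by apply/subsetP => E; rewrite inE => /andP[].
  rewrite -(setID T (avoiding T (X i))) -(setID F (avoiding F (X i))).
  by rewrite dTF (setIidPr (avS T)) (setIidPr (avS F)) avTF.
rewrite -(card_in_imset ginj).
apply: (@leq_trans #|setX G (powerset (edges e :\: avoiding (edges e) (X i)))|).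
  apply/subset_leq_card/subsetP => _ /imsetP[T TB ->].
  rewrite inE (fP T TB).1 /= powersetE; apply/subsetP => E; rewrite !inE.
  move: TB; rewrite !inE => /andP[/asboolP[/subsetP Te _ _] _] /andP[+ ET].
  by have := Te E ET; rewrite ET /= inE => ->; rewrite andbT.
by rewrite cardsX card_powerset leq_mul2l leq_pexp2l ?De ?orbT.
Qed.

End Graphs.

(** * Branches off a path in an acyclic graph *)

Section Branches.
Variables (V : finType) (e : rel V).

Lemma graph_dist_le_walk x p :
  path e x p -> graph_dist e x (last x p) <= size p.
Proof.
move=> xp; rewrite /graph_dist.
have minP (I : eqType) (r : seq I) (P : pred I) F x0 :
    \big[minn/x0]_(i <- r | P i) F i <= x0 /\
    forall i, i \in r -> P i -> \big[minn/x0]_(i <- r | P i) F i <= F i.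
  elim: r => [|j r [IH0 IH]]; first by rewrite big_nil.
  rewrite big_cons; case Pj : (P j); last first.
    by split=> // i; rewrite inE => /orP[/eqP->|]; [rewrite Pj|exact: IH].
  split=> [|i]; first by rewrite geq_min IH0 orbT.
  rewrite inE => /orP[/eqP-> _|ir Pi]; first by rewrite geq_minl.
  by rewrite geq_min IH ?orbT.
(* Walks with at least [#|V|] steps are covered by the default value of the minimum. *)
have [px|px] := ltnP (size p) #|V|; last exact: leq_trans (minP _ _ _ _ _).1 px.
apply: (minP _ _ _ _ _).2 (Ordinal px) _ _; first exact: mem_index_enum.
by apply/existsP; exists (in_tuple p); rewrite xp eqxx.
Qed.

Hypothesis es : symmetric e.
Hypothesis ea : acyclic_graph e.

Definition off_rel (L : seq V) : rel V :=
  [rel u v | [&& u \notin L, v \notin L & e u v]].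

Lemma off_rel_sym L : symmetric (off_rel L).
Proof. by move=> u v; rewrite /off_rel /= es andbCA. Qed.

Lemma connect_restricted_walk (P : pred V) u v
    (r := fun x y => [&& P x, P y & e x y]) :
    P u -> connect r u v ->
  exists p, [/\ path e u p, v = last u p, uniq (u :: p)
    & forall w, w \in u :: p -> P w /\ connect r u w].
Proof.
move=> Pu /connectP[p0 /shortenP[p up pu _] ->]; exists p; split=> //.
  by apply: sub_path up => ? ? /and3P[].
move=> w wp; split; last exact: (path_connect up wp).
move: wp; rewrite inE => /orP[/eqP->//|]; move: w; apply/allP.
by elim: p u up {pu Pu} => //= y p IH u /andP[/and3P[_ -> _] /IH].
Qed.

Lemma connect_off_walk L u v : u \notin L -> connect (off_rel L) u v ->
  exists p, [/\ path e u p, v = last u p, uniq (u :: p)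
    & forall w, w \in u :: p -> w \notin L /\ connect (off_rel L) u w].
Proof. exact: (@connect_restricted_walk [predC L]). Qed.

(** The segment of [L] from [a] to [a'], closed up by a walk off [L] from [w'] to [w], would be a
    cycle with at least three vertices. *)
Lemma attachment_distinct_cycle L1 L2 L3 a a' w w' :
    let L := L1 ++ a :: L2 ++ a' :: L3 in
    sorted e L -> uniq L -> w \notin L -> w' \notin L ->
    connect (off_rel L) w' w -> e w a -> e w' a' -> False.
Proof.
move=> L sL uL wL w'L cw ewa ewa'.
have [p [w'p wE up pL]] := connect_off_walk w'L cw.
suff uc : ucycle e (a :: L2 ++ a' :: w' :: p).
  by have := ea uc; rewrite /= size_cat /=; lia.
pose M := a :: rcons L2 a'.
have LE : L = L1 ++ M ++ L3 by rewrite /L /M /= cat_rcons.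
have cE : a :: L2 ++ a' :: w' :: p = M ++ w' :: p by rewrite /M /= cat_rcons.
apply/andP; split; last first.
  rewrite cE cat_uniq up andbT; apply/andP; split.
    by move: uL; rewrite LE !cat_uniq => /and3P[_ _ /and3P[]].
  apply/hasPn => z /pL[+ _]; apply: contra => zM.
  by rewrite LE !mem_cat; apply/or3P; apply: Or32.
rewrite /= rcons_cat cat_path /= rcons_path -wE w'p ewa (es a') ewa' andbT /=.
move: sL; rewrite /L; case: L1 {LE L wL w'L cw pL uL} => [|b L1] /=.
  by rewrite cat_path /= => /and3P[-> ->].
by rewrite cat_path /= cat_path /= => /and4P[_ _ -> /andP[-> _]].
Qed.

Lemma attachment_unique L a a' w w' :
    sorted e L -> uniq L -> a \in L -> a' \in L -> w \notin L -> w' \notin L ->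
    connect (off_rel L) w w' -> e w a -> e w' a' -> a = a'.
Proof.
move=> sL uL aL a'L wL w'L cw ewa ewa'; apply/eqP/negPn/negP => aa'.
have cw' : connect (off_rel L) w' w.
  by rewrite (sym_connect_sym (off_rel_sym L)).
move: a'L; case/splitPr: L / aL sL uL wL w'L cw cw' => L1 L2 sL uL wL w'L cw cw'.
(* The two cases are the two orders in which [a] and [a'] may occur along [L]. *)
rewrite mem_cat inE eq_sym (negPf aa') /= => /orP[] a'L.
  case/splitPr: L1 / a'L sL uL wL w'L cw cw' => L1 L3; rewrite -catA /=.
  by move=> sL uL wL w'L cw cw'; apply: (attachment_distinct_cycle sL uL _ _ cw).
case/splitPr: L2 / a'L sL uL wL w'L cw cw' => L2 L3.
by move=> sL uL wL w'L cw cw'; apply: (attachment_distinct_cycle sL uL _ _ cw').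
Qed.

(** Follow a simple path inside [X] from [u] towards [x] until it first meets [L]; by uniqueness of
    the attachment vertex, this happens at [a]. *)
Lemma branch_walk_in_connected_set L B a u x (X : {set V}) :
    sorted e L -> uniq L -> is_branch_off e L B a -> u \in B -> x \in L ->
    u \in X -> connect (induced_rel X e) u x ->
  exists q, [/\ path e u q, last u q = a & size q < #|X|].
Proof.
move=> sL uL [[x0 x0L ->] aL [w]]; rewrite !inE => cw ewa cu xL uX.
have off_notin y : connect (off_rel L) x0 y -> y \notin L.
  by move=> /(connect_off_walk x0L)[p [_ -> _ /(_ _ (mem_last x0 p))[]]].
have uL' := off_notin u cu; have wL := off_notin w cw.
move=> /(@connect_restricted_walk (mem X) _ _ uX)[p [up xE pu pX]].
have pn : size p < #|X| by rewrite -[(size p).+1]/(size (u :: p)) -(card_uniqP pu);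
  apply: subset_leq_card; apply/subsetP => z /pX[].
have hp : has (mem L) p.
  apply/hasP; exists x => //; have := mem_last u p; rewrite -xE inE.
  by move=> /orP[/eqP xu|//]; rewrite xu (negPf uL') in xL.
case/split_find: hp up pn => y p1 p2 /= yL p1L; rewrite cat_path rcons_path.
move=> /andP[/andP[up1 ey] _] pn; exists (rcons p1 y).
have p1L' z : z \in u :: p1 -> z \notin L.
  rewrite inE => /orP[/eqP->//|zp]; exact: (hasPn p1L).
have yE : y = a.
  apply: (@attachment_unique L _ _ (last u p1) w) => //.
    by apply: p1L'; apply: mem_last.
  apply: (@connect_trans _ _ u).
    rewrite (sym_connect_sym (off_rel_sym L)); apply/connectP; exists p1 => //.
    apply: (@sub_in_path _ [predC L] e) => //; last by apply/allP.
    by move=> z t zL tL ezt; apply/and3P.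
  by apply: connect_trans cw; rewrite (sym_connect_sym (off_rel_sym L)).
split; rewrite ?last_rcons //; first by rewrite rcons_path up1.
by apply: leq_ltn_trans pn; rewrite size_cat leq_addr.
Qed.

(** Cut the walk at its first vertex from which [a] is reachable in fewer than [D] steps, and finish
    by such a shortcut to get [q]. *)
Lemma far_prefix a D v p : 0 < D -> path e v p -> last v p = a ->
  exists s t q, [/\ v :: p = s ++ t, path e v q, last v q = a, size q < size s + D
    & forall u, u \in s ->
        ~ exists q', [/\ path e u q', last u q' = a & size q' < D]].
Proof.
move=> D0; elim: p v => [|y p IH] v /=.
  by move=> _ va; exists [::], [:: v], [::].
move=> /andP[vy yp] la.
have [[q [vq qa qD]]|far] := pselect (exists q',
  [/\ path e v q', last v q' = a & size q' < D]).
  by exists [::], (v :: y :: p), q.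
have [s [t [q [st yq qa qD fs]]]] := IH y yp la.
exists (v :: s), t, (y :: q); split=> //=; [by rewrite st|by rewrite vy|].
by move=> u; rewrite inE => /orP[/eqP->//|]; apply: fs.
Qed.

(** Start from a vertex of [B] at distance at least [l] from [a]. The walk [q] of [far_prefix] has
    at least [l] steps, so the far part [s] has more than [l - D] vertices. *)
Lemma long_branch_far_path L B a l D :
    0 < D -> 0 < l -> is_branch_off e L B a -> l <= branch_length e B a ->
  exists s, [/\ sorted e s, uniq s, l < size s + D & forall u, u \in s ->
    [/\ u \in B, u \notin L &
        ~ exists q', [/\ path e u q', last u q' = a & size q' < D]]].
Proof.
move=> D0 l0 [[x0 x0L BE] aL [w wB ewa]] lB.
have [v vB lv] : exists2 v, v \in B & l <= graph_dist e v a.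
  apply: contrapT => no; suff : branch_length e B a <= l.-1 by lia.
  apply/bigmax_leqP => v vB; suff : ~~ (l <= graph_dist e v a) by lia.
  by apply/negP => lv; apply: no; exists v.
rewrite BE !inE in vB wB.
have off_notin y : connect (off_rel L) x0 y -> y \notin L.
  by move=> /(connect_off_walk x0L)[p [_ -> _ /(_ _ (mem_last x0 p))[]]].
have vL := off_notin v vB.
have cvw : connect (off_rel L) v w.
  by apply: connect_trans wB; rewrite (sym_connect_sym (off_rel_sym L)).
have [p [vp wE up pL]] := connect_off_walk vL cvw.
have vpa : path e v (rcons p a) by rewrite rcons_path vp -wE.
have [s [t [q [st vq qa qD fs]]]] := far_prefix D0 vpa (last_rcons _ _ _).
have sp u : u \in s -> u \in v :: p.
  move=> us; have : u \in v :: rcons p a by rewrite st mem_cat us.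
  rewrite inE mem_rcons inE => /or3P[/eqP->|/eqP ua|up']; rewrite ?mem_head //.
    by case: (fs u us); exists [::].
  by rewrite inE up' orbT.
have sst : sorted e (s ++ t) by rewrite -st.
exists s; split.
- by move: sst; case: (s) => //= z s'; rewrite cat_path => /andP[].
- have : uniq (v :: rcons p a).
    rewrite -rcons_cons rcons_uniq up andbT; apply/negP => /pL[].
    by rewrite aL.
  by rewrite st cat_uniq => /and3P[].
- apply: leq_ltn_trans lv _; apply: leq_ltn_trans qD.
  by rewrite -qa graph_dist_le_walk.
- move=> u us; have /pL[uL cu] := sp u us; split=> //.
    by rewrite BE inE; apply: connect_trans cu.
  exact: fs.
Qed.

End Branches.

Lemma edge_rel_edges (V : finType) (e : rel V) x y :
  x != y -> e x y -> edge_rel (edges e) x y.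
Proof.
move=> xy exy; rewrite /edge_rel xy inE.
by apply/existsP; exists x; apply/existsP; exists y; rewrite exy eqxx.
Qed.

Lemma edge_rel_sub (V : finType) (e : rel V) (T : {set {set V}}) :
  symmetric e -> T \subset edges e -> subrel (edge_rel T) e.
Proof.
move=> es /subsetP Te x y /andP[xy /Te]; rewrite inE.
case/existsP=> a /existsP[b /andP[eab /eqP E]].
have := set21 x y; have := set22 x y; rewrite E !inE.
by move=> /orP[]/eqP yE /orP[]/eqP xE; move: xy; rewrite xE yE ?eqxx // es.
Qed.

(** * Integer sequences with increments at most one in absolute value *)

Definition unit_step : rel nat := fun a b => (a <= b.+1) && (b <= a.+1).

Lemma unit_step_side k x s :
    path unit_step x s -> k \notin x :: s ->
  forall y, y \in x :: s -> (y < k) = (x < k).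
Proof.
elim: s x => [|z s IH] x /=; first by move=> _ _ y; rewrite inE => /eqP->.
move=> /andP[/andP[xz zx] zs]; rewrite inE negb_or => /andP[kx kzs] y.
rewrite inE => /orP[/eqP->//|/(IH z zs kzs)->].
by move: kzs; rewrite inE negb_or => /andP[kz _]; lia.
Qed.

Lemma unit_step_between k x s :
    path unit_step x s -> minn x (last x s) <= k <= maxn x (last x s) ->
  k \in x :: s.
Proof.
move=> xs hk; apply/negPn/negP => kN.
have := unit_step_side xs kN (mem_last x s).
have : k != x by apply: contraNneq kN => ->; rewrite mem_head.
have : k != last x s by apply: contraNneq kN => ->; rewrite mem_last.
move: (last x s) hk => y; lia.
Qed.

(** The values taken form an interval, and [lo] is their minimum. A missing [k] in the window would
    confine all values to [lo, k), which has fewer than [h] elements. *)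
Lemma unit_step_window s h :
    sorted unit_step s -> 0 < h <= size (undup s) ->
  exists lo, forall k, lo <= k < lo + h -> k \in s.
Proof.
move=> ss /andP[h0 hs].
have ex : exists x, x \in s.
  by case: (s) hs => [|x ? _]; [case: h h0|exists x; rewrite mem_head].
case: (ex_minnP ex) => lo los lomin; exists lo => k /andP[lok klo].
apply/negPn/negP => kN.
have below y : y \in s -> y < k.
  have lo_lt : lo < k.
    by rewrite ltn_neqAle lok andbT; apply: contraNneq kN => <-.
  move=> ys; move: ss kN los ys; case: (s) => // x s' xs kN los ys.
  by rewrite (unit_step_side xs kN ys) -(unit_step_side xs kN los).
have : size (undup s) <= size (iota lo (k - lo)).
  apply: uniq_leq_size; first exact: undup_uniq.
  move=> y; rewrite mem_undup => ys; rewrite mem_iota.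
  by have := below y ys; have := lomin y ys; lia.
by rewrite size_iota; lia.
Qed.

(** * Rings and edges of the wired cylinder *)

Section Cylinder.
Variables n m : nat.

Let G := @wired_adj n m.

Lemma wired_adj_sym : symmetric G.
Proof.
move=> [x|] [y|] //=; rewrite /cyl_adj ![y.2 == x.2]eq_sym ![y.1 == x.1]eq_sym.
by congr orb; congr andb; rewrite orbC.
Qed.

(** The value at the sink is a default; levels are compared only along walks avoiding the sink. *)
Definition level (v : wired_vertex n m) : nat := if v is Some x then x.2 else 0.

Lemma level_unit_step x y :
  x != None -> y != None -> G x y -> unit_step (level x) (level y).
Proof.
case: x => [[i j]|] // _; case: y => [[i' j']|] // _.
rewrite /G /= /cyl_adj /unit_step /= => /orP[/andP[/eqP-> _]|/andP[_ /orP[]/eqP->]];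
by lia.
Qed.

Lemma in_ring_set (v : wired_vertex n m) (k : 'I_m) :
  (v \in ring_set n k) = (if v is Some x then x.2 == k else false).
Proof.
apply/imsetP/idP => [[i _ ->] /=//|].
by case: v => [[i j]|] // /eqP /= ->; exists i.
Qed.

Lemma ring_set_disjoint (j k : 'I_m) :
  j != k -> [disjoint ring_set n j & ring_set n k].
Proof.
move=> jk; rewrite disjoint_subset; apply/subsetP => -[[i x]|];
  by rewrite !inE !in_ring_set //= => /eqP->.
Qed.

Lemma card_ring_set (k : 'I_m) : #|ring_set n k| = n.
Proof. by rewrite card_imset ?card_ord // => i j []. Qed.

Lemma ring_spans_connected (k : 'I_m) :
  1 < n -> spans_connected (edges G) (ring_set n k).
Proof.
move=> n_gt1; set r := induced_rel (ring_set n k) (edge_rel (edges G)).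
have rs : symmetric r by apply/induced_rel_sym/edge_rel_sym.
have n0 : 0 < n by lia.
have c0 (i : 'I_n) : connect r (Some (Ordinal n0, k)) (Some (i, k)).
  case: i => i; elim: i => [|i IH] ni.
    by rewrite (_ : Ordinal n0 = Ordinal ni) //; apply: val_inj.
  have ni' : i < n by lia.
  apply: connect_trans (IH ni') _; apply: connect1.
  rewrite /r /induced_rel !in_ring_set eqxx /=; apply: edge_rel_edges.
    by apply/eqP => -[] /eqP; lia.
  rewrite /G /= /cyl_adj eqxx /=; apply/orP; left; apply/orP; left.
  by apply/eqP/val_inj; rewrite /= modn_small.
apply/spans_connectedP => -[[i j]|] [[i' j']|]; rewrite !in_ring_set //=.
move=> /eqP-> /eqP->; apply: connect_trans (c0 i').
by rewrite (sym_connect_sym rs).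
Qed.

Lemma wired_connected : connected_graph (edge_rel (edges G)).
Proof.
have cs := sym_connect_sym (@edge_rel_sym _ (edges G)).
have c0 x : connect (edge_rel (edges G)) None x.
  case: x => [[i [j jm]]|]; last exact: connect0.
  elim: j jm => [|j IH] jm; first exact/connect1/edge_rel_edges.
  have jm' : j < m by lia.
  apply: connect_trans (IH jm') _; apply/connect1/edge_rel_edges.
    by apply/eqP => -[] /eqP; lia.
  by rewrite /G /= /cyl_adj /= !eqxx orbT.
by move=> x y; apply: connect_trans (c0 y); rewrite cs.
Qed.

(** An edge touching the ring is coded by the column of an end on the ring and by its other end: the
    sink, or a column with a level shift in {-1, 0, 1}. Allowing every column overcounts
    harmlessly. *)
Lemma card_ring_edges (k : 'I_m) :
  #|edges G :\: avoiding (edges G) (ring_set n k)| <= n * (n * 3).+1.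
Proof.
pose f (t : 'I_n * option ('I_n * 'I_3)) : {set wired_vertex n m} :=
  [set Some (t.1, k);
    if t.2 is Some (i, d) then Some (i, insubd k (k + d).-1) else None].
have -> : n * (n * 3).+1 = #|{: 'I_n * option ('I_n * 'I_3)}|.
  by rewrite card_prod card_option card_prod !card_ord.
apply: leq_trans (leq_imset_card f _); apply/subset_leq_card/subsetP => E.
rewrite in_setD => /andP[+ eE]; rewrite inE eE /=; rewrite inE in eE.
case/pred0Pn => v /= /andP[vE]; rewrite in_ring_set.
case: v vE => [[i j]|] // + /eqP /= jk; rewrite {j}jk => vE.
have [w Ew Gw] : exists2 w, E = [set Some (i, k); w] & G (Some (i, k)) w.
  case/existsP: eE => x /existsP[y /andP[Gxy /eqP Exy]].
  move: vE; rewrite Exy !inE => /orP[]/eqP->; first by exists y.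
  by exists x; rewrite 1?setUC // wired_adj_sym.
apply/imsetP; case: w Ew Gw => [[i' j]|] Ew Gw; last first.
  by exists (i, None).
have jk : (j <= k.+1) && (k <= j.+1).
  by have := @level_unit_step (Some (i, k)) (Some (i', j)) isT isT Gw;
    rewrite /unit_step andbC.
(* The level shift is stored increased by one, so that it is a natural number below 3. *)
have dm : j.+1 - k < 3 by lia.
exists (i, Some (i', Ordinal dm)) => //; rewrite Ew /f /=.
congr [set _; Some (_, _)]; apply: val_inj.
rewrite val_insubd; have -> : (k + (j.+1 - k)).-1 = j by lia.
by rewrite ltn_ord.
Qed.

End Cylinder.

(** * Sink-trunks and their long branches *)

Section Trunk.
Variables n m : nat.
Hypothesis n_gt0 : 0 < n.
Hypothesis m_gt0 : 0 < m.

Let G := @wired_adj n m.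

Variable T : {set {set wired_vertex n m}}.
Hypothesis T_tree : is_spanning_tree G T.

Let es : symmetric (edge_rel T) := @edge_rel_sym _ T.
Let TG : subrel (edge_rel T) G.
Proof. by case: T_tree => Te _ _; apply: edge_rel_sub Te; apply: wired_adj_sym. Qed.

Let r (x y : wired_vertex n m) := [&& x != None, y != None & edge_rel T x y].

Let r_sym : connect_sym r.
Proof. by apply: sym_connect_sym => x y; rewrite /r es andbCA. Qed.

(** After its first step the path stays away from the sink, so its level changes by at most one per
    step and skips no ring. *)
Let sink_path u y (U := Some u : wired_vertex n m) :
    edge_rel T None U -> connect r U y ->
  exists p, [/\ path (edge_rel T) None p, uniq (None :: p),
    forall z, z \in p -> z != None /\ connect r U z &
    forall k, minn (level U) (level y) <= k <= maxn (level U) (level y) ->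
      exists2 z, z \in p & z != None /\ level z = k].
Proof.
move=> eU /(@connect_restricted_walk _ (edge_rel T) (fun v => v != None) U y isT).
move=> [p [Up -> up pP]]; exists (U :: p); split.
- by rewrite /= eU.
- by rewrite cons_uniq up andbT; apply/negP => /pP[].
- exact: pP.
- move=> k; rewrite -last_map => kU.
  have Np : all (fun v => v != None) (U :: p) by apply/allP => z /pP[].
  have pu : path unit_step (level U) (map (@level n m) p).
    rewrite path_map.
    apply: (@sub_in_path _ (fun v => v != None) (edge_rel T)) => //.
    by move=> x z xN zN xz; apply: level_unit_step => //; apply: TG.
  have := unit_step_between pu kU.
  rewrite -map_cons => /mapP[z zp kz]; exists z => //; split=> //.
  by case: (pP z zp).
Qed.

(** The component of [y] in the tree with the sink removed hangs from the sink by an edge to the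
    bottom ring. *)
Let from_bottom (y : cyl_vertex n m) :=
  [exists u : cyl_vertex n m,
    [&& u.2 == 0 :> nat, edge_rel T None (Some u) & connect r (Some u) (Some y)]].

Let from_top (y : cyl_vertex n m) :=
  [exists u : cyl_vertex n m,
    [&& u.2.+1 == m, edge_rel T None (Some u) & connect r (Some u) (Some y)]].

Let from_bottom_or_top y : from_bottom y || from_top y.
Proof.
case: T_tree => _ /(_ None (Some y)) /connectP[p0 /shortenP[p pp up _] yE] _.
case: p pp up yE => [//|u p] /= /andP[eu up] /andP[uN _] yE.
have Gu := TG eu.
have cu : connect r u (Some y).
  apply/connectP; exists p => //.
  apply: (@sub_in_path _ (fun v => v != None) (edge_rel T)) => //.
    by move=> x z xN zN xz; apply/and3P.
  by apply/allP => z zp; apply: contraNneq uN => <-.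
case: u {up uN yE} eu Gu cu => // u eu /orP[] Gu cu; apply/orP; [left|right];
  by apply/existsP; exists u; apply/and3P.
Qed.

Let from_bottom_connect y z :
  connect r (Some y) (Some z) -> from_bottom y -> from_bottom z.
Proof.
move=> yz /existsP[u /and3P[u0 eu cu]]; apply/existsP; exists u.
by rewrite u0 eu (connect_trans cu).
Qed.

(* Join at the sink an arm through the bottom reaching the highest possible ring
   and an arm through the top reaching the next ring: by maximality they do not
   meet. *)
Lemma exists_sink_trunk : exists L, is_sink_trunk T L.
Proof.
(* [K] counts the rings up to the highest one reached from the bottom, and is 0 if there is none;
   the bottom arm is then empty. *)
pose K := \max_(y | from_bottom y) (y.2 : nat).+1.
have below y : from_bottom y -> y.2 < K.
  by move=> yb; exact: (@leq_bigmax_cond _ from_bottom (fun y => (y.2 : nat).+1)).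
have [p [ep up pA pK]] : exists p, [/\ path (edge_rel T) None p,
    uniq (None :: p),
    forall z, z \in p -> if z is Some x then from_bottom x else false &
    forall k, k < K -> exists2 z, z \in p & z != None /\ level z = k].
  have [/eqP/pred0P A0|] := eqVneq #|from_bottom| 0.
    by exists [::]; split=> // k; rewrite /K big_pred0.
  rewrite -lt0n => /(eq_bigmax_cond (fun y : cyl_vertex n m => (y.2 : nat).+1))[y yb KE].
  have {}KE : K = y.2.+1 by rewrite -KE.
  case/existsP: (yb) => u /and3P[/eqP u0 eu cu].
  have [p [ep up pP pk]] := sink_path eu cu; exists p; split=> //.
    move=> [z|] /pP[] // _ cz; apply/existsP; exists u.
    by rewrite u0 eqxx eu.
  move=> k kK; apply: pk; rewrite /level u0; lia.
have [q [eq uq qA qK]] : exists q, [/\ path (edge_rel T) None q,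
    uniq (None :: q),
    forall z, z \in q -> if z is Some x then ~~ from_bottom x else false &
    forall k, K <= k < m -> exists2 z, z \in q & z != None /\ level z = k].
  have [mK|Km] := leqP m K.
    by exists [::]; split=> // k; lia.
  (* Any vertex of ring [K] will do: by maximality it is reached from the top only. *)
  pose y : cyl_vertex n m := (Ordinal n_gt0, Ordinal Km).
  have yb : ~~ from_bottom y by apply/negP => /below; rewrite ltnn.
  have := from_bottom_or_top y; rewrite (negPf yb) /=.
  case/existsP=> u /and3P[/eqP um eu cu].
  have [p' [ep' up' pP pk]] := sink_path eu cu; exists p'; split=> //.
    move=> [z|] /pP[] // _ cz; apply: contra yb; apply: from_bottom_connect.
    by apply: connect_trans cu; rewrite r_sym.
  by move=> k kK; apply: pk; rewrite -[level (Some y)]/K -[level _]/(u.2 : nat); lia.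
exists (rev (None :: p) ++ q); split; last first.
  by rewrite mem_cat mem_rev mem_head.
split.
  apply/and3P; split.
  - by rewrite rev_cons -cats1 -catA; case: (rev p).
  - have : sorted (edge_rel T) (rev (None :: p)).
      rewrite rev_sorted /= (eq_path (e' := edge_rel T)) //.
    rewrite rev_cons; case: (rev p) => [|x s] //=; rewrite cat_path last_rcons.
    by move=> ->.
  - move: uq; rewrite cons_uniq => /andP[qN uq].
    rewrite cat_uniq rev_uniq up uq andbT /=.
    apply/hasPn => z zq; rewrite mem_rev inE negb_or.
    apply/andP; split; first by apply: contraNneq qN => <-.
    by apply/negP => /pA; have := qA z zq; case: z {zq} => // z /negPf->.
move=> k; have [z zL [zN zk]] : exists2 z, z \in rev (None :: p) ++ q
    & z != None /\ level z = k.
  have [kK|Kk] := ltnP k K.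
    have [z zp zk] := pK k kK; exists z => //.
    by rewrite mem_cat mem_rev inE zp orbT.
  have [|z zq zk] := qK k; first by rewrite Kk ltn_ord.
  by exists z => //; rewrite mem_cat zq orbT.
by exists z => //; rewrite in_ring_set; case: z zN zk {zL} => // x _ /= /val_inj->.
Qed.

(** The far path has more than [l - n] vertices, at most [n] on each ring, so it meets a window of
    (l - n) / n consecutive rings. A good ring among them would give one of its vertices a walk of
    fewer than [n] steps to [a]. *)
Lemma long_branch_disconnected_rings L B a l :
    is_sink_trunk T L -> 0 < l -> is_branch_off (edge_rel T) L B a ->
    l <= branch_length (edge_rel T) B a ->
  exists2 lo : 'I_m, lo + (l - n) %/ n <= m &
    forall j : 'I_m, lo <= j < lo + (l - n) %/ n ->
      ~~ spans_connected T (ring_set n j).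
Proof.
move=> [[/and3P[_ sL uL] Lk] NL] l0 br lB; set h := _ %/ _.
have Ta : acyclic_graph (edge_rel T) by case: T_tree.
have [h0|h0] := posnP h.
  (* The window is empty here, in particular when [l < n], where the subtraction truncates to 0. *)
  by exists (Ordinal m_gt0); rewrite h0 //= => j; lia.
have [s [ss us sl sP]] := long_branch_far_path es n_gt0 l0 br lB.
have sN u : u \in s -> u != None.
  by move=> /sP[_ uL' _]; apply: contraNneq uL' => ->.
pose t := map (@level n m) s.
have st : sorted unit_step t.
  rewrite sorted_map.
  apply: (@sub_in_sorted _ (fun v => v != None) (edge_rel T)) => //.
    by move=> x z xN zN xz; apply: level_unit_step => //; apply: TG.
  exact/allP.
(* Vertices off the sink are determined by their column and level. *)
have sz : size s <= n * size (undup t).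
  have -> : n * size (undup t) = size [seq (i, j) | i <- enum 'I_n, j <- undup t].
    by rewrite size_allpairs size_enum_ord.
  pose f (v : wired_vertex n m) : 'I_n * nat :=
    if v is Some x then (x.1, x.2 : nat) else (Ordinal n_gt0, 0).
  rewrite -(size_map f); apply: uniq_leq_size.
    rewrite map_inj_in_uniq // => -[[i j]|] [[i' j']|] /sN // _ /sN // _ [-> ?].
    by congr (Some (_, _)); apply: val_inj.
  move=> _ /mapP[v vs ->]; apply/allpairsP; exists (f v); split.
  - exact: mem_enum.
  - rewrite mem_undup; apply/mapP; exists v => //.
    by case: v {vs}.
  - by case: (f v).
have ht : 0 < h <= size (undup t).
  rewrite h0 -(@leq_pmul2l n) //; have : h * n <= l - n by apply: leq_divM.
  lia.
have [lo lot] := unit_step_window st ht.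
have tm k : k \in t -> k < m.
  by case/mapP => -[x|] /sN // _ ->; apply: ltn_ord.
have lom : lo < m by apply: tm; apply: lot; lia.
exists (Ordinal lom) => /=.
  have := tm (lo + h).-1; have := lot (lo + h).-1; move=> a1 a2.
  have : (lo + h).-1 < m by apply/a2/a1; lia.
  lia.
move=> j /lot /mapP[v vs jv]; apply/negP => jT.
have [vB vL] := sP v vs; apply.
have vj : v \in ring_set n j.
  by rewrite in_ring_set; have := sN v vs; case: (v) jv => // x /= /val_inj->.
have [x xL xj] := Lk j.
have := branch_walk_in_connected_set es Ta sL uL br vB xL vj.
rewrite card_ring_set; apply.
exact: (spans_connectedP _ _ jT).
Qed.

End Trunk.

(** * Union bound and choice of constants *)

Definition good_tree n m l (T : {set {set wired_vertex n m}}) : Prop :=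
  exists2 L : seq (wired_vertex n m), is_sink_trunk T L
  & forall (B : {set wired_vertex n m}) (a : wired_vertex n m),
      is_branch_off (edge_rel T) L B a ->
      (branch_length (edge_rel T) B a < l)%N.

Lemma card_bad_trees n m l (h := (l - n) %/ n) (D := n * (n * 3).+1)
    (Omega := spanning_trees (@wired_adj n m)) :
    1 < n -> 0 < m -> 0 < l ->
  #|[set T in Omega | ~~ `[< good_tree l T >]]| * (2 ^ D) ^ h
    <= m * ((2 ^ D).-1 ^ h * #|Omega|).
Proof.
move=> n1 m0 l0; have n0 := ltnW n1.
pose J (lo : 'I_m) := [set j : 'I_m | lo <= j < lo + h].
(* Only windows that fit in the cylinder count, so that [J lo] has exactly [h] elements. *)
pose bad (lo : 'I_m) :=
  if lo + h <= m then disconnecting_trees (@wired_adj n m) (@ring_set n m) (J lo)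
  else set0.
have badle lo : #|bad lo| * (2 ^ D) ^ h <= (2 ^ D).-1 ^ h * #|Omega|.
  rewrite /bad; case: ifP => hm; last by rewrite cards0 mul0n.
  have Jh : #|J lo| = h.
    rewrite cardE -(size_map val) -(size_iota lo h); apply/perm_size/uniq_perm.
    - by rewrite map_inj_uniq ?enum_uniq //; apply: val_inj.
    - exact: iota_uniq.
    move=> k; rewrite mem_iota; apply/mapP/idP => [[j]|kJ].
      by rewrite mem_enum inE => ? ->.
    have km : k < m by lia.
    by exists (Ordinal km); rewrite // mem_enum inE.
  rewrite -{1 2}Jh; apply: card_disconnecting_trees.
  - exact: ring_set_disjoint.
  - by move=> j; apply: ring_spans_connected.
  - exact: card_ring_edges.
have sub : [set T in Omega | ~~ `[< good_tree l T >]] \subset \bigcup_lo bad lo.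
  apply/subsetP => T; rewrite inE => /andP[TO /asboolPn nT].
  have Tt : is_spanning_tree (@wired_adj n m) T.
    by move: TO; rewrite inE => /asboolP.
  have [L LT] := exists_sink_trunk n0 m0 Tt.
  have [B [a [br lB]]] : exists B a, is_branch_off (edge_rel T) L B a
      /\ l <= branch_length (edge_rel T) B a.
    apply: contrapT => no; apply: nT; exists L => // B a br.
    by rewrite ltnNge; apply/negP => lB; apply: no; exists B, a.
  have [lo hm bd] := long_branch_disconnected_rings n0 m0 Tt LT l0 br lB.
  apply/bigcupP; exists lo => //; rewrite /bad hm inE TO /=.
  by apply/forall_inP => j; rewrite inE => /bd.
apply: (@leq_trans ((\sum_lo #|bad lo|) * (2 ^ D) ^ h)).
  rewrite leq_mul2r (leq_trans (subset_leq_card sub)) ?orbT //.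
  elim/big_ind2: _ => [|a A b B Aa Bb|//]; first by rewrite cards0.
  by apply: leq_trans (leq_card_setU A B).1 _; apply: leq_add.
rewrite big_distrl /=; apply: (@leq_trans (\sum_(lo < m) (2 ^ D).-1 ^ h * #|Omega|)).
  by apply: leq_sum.
by rewrite sum_nat_const card_ord.
Qed.

Lemma bernoulli_sub (R : realDomainType) (x : R) k :
  (0 <= x <= 1 -> 1 - k%:R * x <= (1 - x) ^+ k)%R.
Proof.
move=> x01; elim: k => [|k IH]; first by rewrite mul0r subr0 expr0.
have k0 : (0 <= k%:R :> R)%R := ler0n R k.
rewrite exprS -natr1; nra.
Qed.

Theorem theorem2 (R : realType) (n : nat) (hn : 3 <= n) :
  exists C theta : R,
    [/\ (0 < theta)%R, (theta < 1)%R
      & forall m l : nat, 2 <= m -> 1 <= l ->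
        (1 - C * m%:R ^+ 3 * theta ^+ l <=
         ust_prob R (@wired_adj n m) (fun T =>
           exists2 L : seq (wired_vertex n m), is_sink_trunk T L
           & forall (B : {set wired_vertex n m}) (a : wired_vertex n m),
               is_branch_off (edge_rel T) L B a ->
               (branch_length (edge_rel T) B a < l)%N))%R].
Proof.
pose N := (2 ^ (n * (n * 3).+1))%N.
have N2 : (2 <= N)%N by rewrite -[leqLHS]expn1 leq_exp2l //; nia.
have n0 : (0 < n)%N by apply: leq_trans hn.
have N0 : (0 < N)%N by apply: leq_trans N2.
have NR : (2 <= N%:R :> R)%R by rewrite ler_nat.
have nR : (3 <= n%:R :> R)%R by rewrite ler_nat.
have n_neq0 : (n%:R != 0 :> R)%R by rewrite pnatr_eq0; lia.
have N_neq0 : (N%:R != 0 :> R)%R by rewrite pnatr_eq0; lia.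
(* With this [x], Bernoulli's inequality gives theta^n >= 1 - n x = 1 - 1/N, which avoids taking an
   n-th root. *)
pose x : R := (n%:R * N%:R)^-1%R.
have nN : (6 <= n%:R * N%:R :> R)%R by nra.
have x0 : (0 < x)%R by rewrite invr_gt0; lra.
have x1 : (x < 1)%R by rewrite invf_lt1; lra.
pose theta : R := (1 - x)%R.
have t0 : (0 < theta)%R by rewrite /theta; lra.
have t1 : (theta < 1)%R by rewrite /theta; lra.
have tn : (N.-1%:R / N%:R <= theta ^+ n)%R.
  apply: le_trans (_ : 1 - n%:R * x <= _)%R; last by apply: bernoulli_sub; lra.
  rewrite /x invfM mulrA divff // mul1r -subn1 natrB; last by lia.
  by rewrite mulrBl divff // mul1r.
(* The constant absorbs the at most [2 * n] steps of length lost between [l] and [n * h]. *)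
exists (theta ^- (2 * n))%R, theta; split=> // m l m2 l1.
set P := fun T => _; set Omega := spanning_trees (@wired_adj n m).
pose bad := [set T in Omega | ~~ `[< P T >]].
have badle := card_bad_trees (ltnW hn) (ltnW m2) l1.
have Omega0 : (0 < #|Omega|)%N.
  have [T Tt] := exists_spanning_tree (@wired_connected n m).
  by apply/card_gt0P; exists T; rewrite inE; apply/asboolP.
have OR : (0 < #|Omega|%:R :> R)%R by rewrite ltr0n.
have OE : (#|[set T in Omega | `[< P T >]]| + #|bad| = #|Omega|)%N.
  rewrite -(cardsID [set T | `[< P T >]] Omega); congr (_ + _)%N.
    by congr #|pred_of_set _|; apply/setP => T; rewrite !inE.
  by congr #|pred_of_set _|; apply/setP => T; rewrite !inE andbC.
rewrite /ust_prob -/Omega ler_pdivlMr //.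
set h := ((l - n) %/ n)%N in badle.
have hE : (l <= n * h + 2 * n)%N.
  have := ltn_pmod (l - n) n0; have := divn_eq (l - n) n; rewrite -/h.
  by move: (_ %% _)%N (h) => r q; clear; lia.
have mR : (2 <= m%:R :> R)%R by rewrite ler_nat.
have bR : (#|bad|%:R <= m%:R * (N.-1%:R / N%:R) ^+ h * #|Omega|%:R :> R)%R.
  rewrite expr_div_n -mulrA (mulrAC (_ ^+ _)%R) !mulrA.
  rewrite ler_pdivlMr ?exprn_gt0 ?ltr0n //.
  rewrite -!natrX -!natrM ler_nat.
  by rewrite -mulnA; exact: badle.
have qh : ((N.-1%:R / N%:R) ^+ h <= theta ^- (2 * n) * theta ^+ l :> R)%R.
  apply: (@le_trans _ _ (theta ^+ (n * h))%R).
    by rewrite exprM lerXn2r // nnegrE ?divr_ge0 ?exprn_ge0 ?ler0n // ltW.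
  rewrite mulrC ler_pdivlMr ?exprn_gt0 // -exprD.
  by rewrite ler_wiXn2l // ltW.
set c := (theta ^- (2 * n) * theta ^+ l)%R in qh.
have c0 : (0 <= c)%R by rewrite mulr_ge0 ?invr_ge0 ?exprn_ge0 // ltW.
have -> : (theta ^- (2 * n) * m%:R ^+ 3 * theta ^+ l = c * m%:R ^+ 3)%R.
  by rewrite mulrAC.
(* The union bound yields a factor m, which is at most m^3. *)
have bc : (#|bad|%:R <= c * m%:R ^+ 3 * #|Omega|%:R)%R.
  apply: le_trans bR _; rewrite ler_pM2r // mulrC.
  apply: ler_pM => //; first by rewrite exprn_ge0 // divr_ge0.
  by rewrite ler_eXnr //; lra.
have := congr1 (fun k => k%:R : R)%R OE; rewrite /= natrD => OER.
rewrite mulrBl mul1r; lra.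
Qed.
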